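(* Let $n\ge1$ and let $V=\mathbb{R}^{2n}$ have canonical coordinates $(t,\boldsymbol x,y,\boldsymbol z)$, with $\boldsymbol x,\boldsymbol z$ being $(n-1)$-dimensional vectors and $\omega=dt\wedge dy+d\boldsymbol x\wedge d\boldsymbol z$. Consider a smooth curve $\boldsymbol x=\boldsymbol x(t)$, $y=y(t)$, $\boldsymbol z=\boldsymbol z(t)$ in $V$ and a point $A_1$ on it at which $ty_t-y+\boldsymbol x\boldsymbol z_t-\boldsymbol x_t\boldsymbol z\ne0$. Let $A_0,A_2$ be points of the curve such that $A_1$ lies between $A_0$ and $A_2$ (with respect to the parameter $t$). Then $$\lim_{A_0,A_2\to A_1}\frac{\mathrm{Area}_\omega(A_0A_1A_2)}{\mathrm{Area}_\omega(OA_0A_1)\,\mathrm{Area}_\omega(OA_0A_2)\,\mathrm{Area}_\omega(OA_1A_2)}=\frac{2(\boldsymbol x_t\boldsymbol z_{tt}-\boldsymbol x_{tt}\boldsymbol z_t+y_{tt})}{(ty_t-y+\boldsymbol x\boldsymbol z_t-\boldsymbol x_t\boldsymbol z)^3}$$ and $$\lim_{A_0\to A_1}\frac{\overrightarrow{A_0A_1}}{\mathrm{Area}_\omega(OA_0A_1)}=\frac{2\,\mathcal{D}_t}{ty_t-y+\boldsymbol x\boldsymbol z_t-\boldsymbol x_t\boldsymbol z},$$ where the right-hand sides are evaluated at $A_1$.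
   Context: $O$ is the origin of $V$. For points $P,Q,S\in V$, $\mathrm{Area}_\omega(PQS)=\tfrac12\,\omega(\overrightarrow{PQ},\overrightarrow{PS})$ is the oriented symplectic area; in particular $\mathrm{Area}_\omega(OA_iA_j)=\tfrac12a_{ij}$ with $a_{ij}=\omega(\overrightarrow{OA_i},\overrightarrow{OA_j})$, and $\mathrm{Area}_\omega(A_0A_1A_2)=\tfrac12(a_{01}-a_{02}+a_{12})$. Points are ordered so that the parameter values satisfy $t(A_0)=t-\delta$, $t(A_1)=t$, $t(A_2)=t+\epsilon$ with $\delta,\epsilon>0$ tending to $0$ independently. Subscripts $t$ denote derivatives along the curve with respect to $t$, and products such as $\boldsymbol x\boldsymbol z_t$ are dot products. Along the curve the total derivative $\mathcal{D}_t$ is identified with the tangent vector $\partial_t+\boldsymbol x_t\partial_{\boldsymbol x}+y_t\partial_y+\boldsymbol z_t\partial_{\boldsymbol z}$. *)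

(* Defs.v *)
From HB Require Import structures.
From mathcomp Require Import all_boot all_order all_algebra.
From mathcomp Require Import all_classical all_reals all_analysis.
Import Order.TTheory GRing.Theory Num.Theory.
Import numFieldNormedType.Exports.
Set Implicit Arguments.
Unset Strict Implicit.
Unset Printing Implicit Defensive.
Local Open Scope ring_scope.
Local Open Scope classical_set_scope.

(* The half-dimension n >= 1 is written m.+1, so that x and z are vectors of
   length n - 1 = m.  Coordinates are stored in the order (t, x, y, z). *)
Definition phase (R : realType) (m : nat) := 'rV[R]_((1 + m) + (1 + m)).

Section Coordinates.
Context {R : realType} {m : nat}.

Definition vec (t : R) (x : 'rV[R]_m) (y : R) (z : 'rV[R]_m) : phase R m :=
  row_mx (row_mx t%:M x) (row_mx y%:M z).

Definition tcoord (v : phase R m) : R := lsubmx (lsubmx v) 0 0.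
Definition xcoord (i : 'I_m) (v : phase R m) : R := rsubmx (lsubmx v) 0 i.
Definition ycoord (v : phase R m) : R := lsubmx (rsubmx v) 0 0.
Definition zcoord (i : 'I_m) (v : phase R m) : R := rsubmx (rsubmx v) 0 i.

(* Normalized without the factor 1/2. *)
Definition wedge (a b : phase R m -> R) (u v : phase R m) : R :=
  a u * b v - a v * b u.

Definition omega (u v : phase R m) : R :=
  wedge tcoord ycoord u v + \sum_(i < m) wedge (xcoord i) (zcoord i) u v.

Definition area (P Q S : phase R m) : R := 2^-1 * omega (Q - P) (S - P).

Definition dot (u v : 'rV[R]_m) : R := \sum_(i < m) u 0 i * v 0 i.

Section Curve.
Variables (x : R -> 'rV[R]_m) (y : R -> R) (z : R -> 'rV[R]_m).

Definition curve (t : R) : phase R m := vec t (x t) (y t) (z t).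

(* The tangent vector d_t + x_t d_x + y_t d_y + z_t d_z. *)
Definition total_derivative (t : R) : phase R m :=
  vec 1 (derive1 x t) (derive1 y t) (derive1 z t).

End Curve.

End Coordinates.

(* Meant for open D: then the iterated derivatives on D do not depend on the
   values of f outside D. *)
Definition smooth_on (R : realType) (W : normedModType R) (D : set R)
    (f : R -> W) : Prop :=
  forall (k : nat) (t : R), D t -> derivable (derive1n k f) t 1.

(* Main.v *)
Require Import Defs.
From HB Require Import structures.
From mathcomp Require Import all_boot all_order all_algebra.
From mathcomp Require Import all_classical all_reals all_analysis.
From mathcomp Require Import ring lra.
Import Order.TTheory GRing.Theory Num.Theory.
Import numFieldNormedType.Exports.
Local Open Scope ring_scope.
Local Open Scope classical_set_scope.

(* By Taylor's formula the chords from A(t) to A(t - d) and A(t + e) are d and e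
   times slopes S = D_t - d B and S' = D_t + e B', where B and B' tend to half
   the second derivative of A.  By bilinearity of omega,
     Area(A0 A1 A2) = d e / 2 * omega(S, S'),
   and omega(S, S') / (d + e) is a weighted mean, with weights d and e, of two
   quantities tending to omega(A_t, A_tt) / 2.  The same device handles
   Area(O A0 A2) / (d + e), so d and e may tend to 0 independently. *)

(** * Entrywise limits and derivatives, and the second-order Taylor formula *)

Lemma cvg_mxP {T : Type} {F : set_system T} {FF : Filter F}
    {R : numFieldType} {m n : nat} (f : T -> 'M[R]_(m, n)) (M : 'M[R]_(m, n)) :
  f @ F --> M <-> forall i j, f x i j @[x --> F] --> M i j.
Proof.
split=> [fM i j|fM A [P MP PA]].
  exact: (cvg_comp _ _ fM (@coord_continuous _ _ _ i j M)).
(* Neighbourhoods of a matrix contain products of neighbourhoods [P i j] of its entries; the index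
   sets being finite, the entrywise conditions hold simultaneously along [F]. *)
rewrite /nbhs/=; apply: filterS (_ : F (fun x => forall i j, P i j (f x i j))).
  by move=> x Px; exact: PA.
by apply: filter_forall => i; apply: filter_forall => j; exact: fM.
Qed.

Lemma is_derive_mx_entry {R : realFieldType} {V : normedModType R} {m n : nat}
    (f : V -> 'M[R]_(m, n)) (u v : V) (df : 'M[R]_(m, n)) i j :
  is_derive u v f df -> is_derive u v (fun x => f x i j) (df i j).
Proof.
move=> [fd <-]; rewrite (derive_mx fd) mxE.
by apply: derivableP; exact: (derivable_mxP f u v).1.
Qed.

(** One application of L'Hopital's rule to [h] and [e ^+ 2] reduces the limit to the derivative of
    [df] at [t]. The factor [s] lets a limit from the right also describe the approach to [t] from
    the left. *)
Lemma taylor2_at_right {R : realType} (f df : R -> R) (t s ddf : R) :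
  (\forall u \near t, is_derive (u : R) 1 f (df u)) -> is_derive t 1 df ddf ->
  (f (t + s * e) - f t - s * e * df t) / e ^+ 2 @[e --> 0^'+] -->
  s ^+ 2 / 2 * ddf.
Proof.
move=> fd f'd; pose l e := t + s * e.
have ld (e : R) : is_derive e 1 l s.
  have := is_deriveD (is_derive_cst t e 1) (is_deriveZ s (is_derive_id e 1)).
  by rewrite add0r /GRing.scale/= mulr1.
have lc (e : R) : {for e, continuous l}.
  by apply/differentiable_continuous/derivable1_diffP; case: (ld e).
have l0 : l 0 = t by rewrite /l mulr0 addr0.
(* Pulling the neighbourhood of [t] on which [f] has derivative [df] back along [l] gives the radius
   [b] around 0. *)
have := fd; rewrite -{1}l0 => /(lc 0).
rewrite nbhs_simpl/= => /nbhs_ballP[b /= b0 bf].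
pose h e := f (t + s * e) - f t - s * e * df t.
have hd (e : R) : `|e| < b -> is_derive e 1 h (s * (df (l e) - df t)).
  move=> eb.
  have fe : is_derive (l e) 1 f (df (l e)).
    by apply: bf; rewrite /ball/= sub0r normrN.
  have := is_deriveB (is_deriveB (@is_derive1_comp R f l e _ _ fe (ld e))
    (is_derive_cst (f t) e 1)) (is_deriveZ (s * df t) (is_derive_id e 1)).
  rewrite subr0 /GRing.scale/= mulr1 mulrBr (mulrC (df (l e))).
  suff -> : h = (f \o l) - cst (f t) - (s * df t) \*: id by [].
  by apply/funext => u; rewrite /h !fctE/= /GRing.scale/= mulrAC.
have fdf (e : R) : e \in `]0, b[%R -> is_derive e 1 h (s * (df (l e) - df t)).
  by rewrite in_itv/= => /andP[e0 eb]; apply: hd; rewrite gtr0_norm.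
have gdg (e : R) : e \in `]0, b[%R -> is_derive e 1 (fun e => e ^+ 2) (2 * e).
  move=> _; have := is_deriveX 2 (is_derive_id e 1).
  by rewrite /GRing.scale/= mulr1 expr1.
apply: (lhopital_at_right b0 fdf gdg).
- apply: cvg_at_right_filter.
  have h0 : h 0 = 0 by rewrite /h -/(l 0) l0 subrr mulr0 mul0r subrr.
  rewrite -{2}h0; apply/differentiable_continuous/derivable1_diffP.
  by case: (hd 0) => //; rewrite normr0.
- apply: cvg_at_right_filter.
  have := @exprn_continuous R 2 0; rewrite /continuous_at expr0n.
  exact.
- by move=> e; rewrite in_itv/= => /andP[e0 _]; rewrite mulf_neq0// gt_eqF.
(* The quotient of the derivatives, [s * (df (l e) - df t) / (2 * e)], is [s / 2] times the
   difference quotient of [df \o l] at 0, whose limit is [ddf * s] by the chain rule. *)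
- apply: cvg_dnbhs_at_right.
  have dfi : is_derive (l 0) 1 df ddf by rewrite l0.
  have [kd kE] := @is_derive1_comp R df l 0 _ _ dfi (ld 0).
  have : h^-1 *: ((df \o l) (h *: 1 + 0) - (df \o l) 0) @[h --> 0^'] -->
      ddf * s by rewrite -kE; exact: kd.
  move=> /cvgM /(_ (cvg_cst (s / 2))).
  rewrite (_ : _ * (s / 2) = s ^+ 2 / 2 * ddf); last by ring.
  apply: cvg_trans; apply: near_eq_cvg; near=> e => /=.
  rewrite /GRing.scale/= mulr1 addr0 l0.
  have e0 : e != 0 by near: e; exact: nbhs_dnbhs_neq.
  by field.
Unshelve. all: by end_near. Qed.

Lemma taylor2_mx_at_right {R : realType} {m n : nat} (f : R -> 'M[R]_(m, n)) (t s : R) :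
  (\forall u \near t, derivable f u 1) -> derivable (derive1 f) t 1 ->
  (e ^+ 2)^-1 *: (f (t + s * e) - f t - (s * e) *: derive1 f t) @[e --> 0^'+] -->
  (s ^+ 2 / 2) *: derive1n 2 f t.
Proof.
move=> fd f'd; apply/cvg_mxP => i j.
rewrite mxE; under eq_fun do rewrite !mxE mulrC.
apply: (@taylor2_at_right R (fun u => f u i j) (fun u => derive1 f u i j)).
  near=> u; apply: is_derive_mx_entry; rewrite derive1E; apply: derivableP.
  by near: u.
by apply: is_derive_mx_entry; rewrite /= derive1E; exact: derivableP.
Unshelve. all: by end_near. Qed.

(** * Continuity and bilinearity of the symplectic form, and limits of weighted means *)

Lemma cvg_vec {R : realType} {m : nat} {T : Type} {F : set_system T} {FF : Filter F}
    (a c : T -> R) (b d : T -> 'rV[R]_m) (a' c' : R) (b' d' : 'rV[R]_m) :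
  a @ F --> a' -> b @ F --> b' -> c @ F --> c' -> d @ F --> d' ->
  vec (a x) (b x) (c x) (d x) @[x --> F] --> vec a' b' c' d'.
Proof.
move=> aF /cvg_mxP bF cF /cvg_mxP dF; apply/cvg_mxP => i j; rewrite /vec.
case: (split_ordP j) => {}j ->; case: (split_ordP j) => {}j ->;
  rewrite ?(row_mxEl, row_mxEr) ?mxE ?ord1 ?eqxx ?mulr1n;
  under eq_fun do rewrite ?(row_mxEl, row_mxEr) ?mxE ?ord1 ?eqxx ?mulr1n; rewrite ?ord1.
- exact: aF.
- exact: bF.
- exact: cF.
- exact: dF.
Qed.

Lemma cvg_omega {R : realType} {m : nat} {T : Type} {F : set_system T} {FF : Filter F}
    (f g : T -> phase R m) (u v : phase R m) :
  f @ F --> u -> g @ F --> v -> omega (f x) (g x) @[x --> F] --> omega u v.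
Proof.
move=> /cvg_mxP fu /cvg_mxP gv.
(* The coordinate functions are entries of the row, so every summand of [omega] is a 2 by 2 minor of
   this shape. *)
have wedge_cvg (i j : 'I_((1 + m) + (1 + m))) :
   f x 0 i * g x 0 j - g x 0 i * f x 0 j @[x --> F] -->
   u 0 i * v 0 j - v 0 i * u 0 j.
  by apply: cvgB; apply: cvgM; (exact: fu || exact: gv).
rewrite /omega /wedge /tcoord /ycoord /xcoord /zcoord.
apply: cvgD.
  under eq_fun do rewrite !mxE.
  by rewrite !mxE; exact: wedge_cvg.
under eq_fun do under eq_bigr do rewrite !mxE.
under eq_bigr do rewrite !mxE.
apply: cvg_big => [|i _]; last exact: wedge_cvg.
exact: add_continuous.
Qed.

(** The shape [a *: u + v] is that in which slopes and endpoints of chords are written below. *)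
Lemma omega_linearl {R : realType} {m : nat} (a : R) (u v w : phase R m) :
  omega (a *: u + v) w = a * omega u w + omega v w.
Proof.
rewrite /omega /wedge /tcoord /ycoord /xcoord /zcoord.
rewrite mulrDr mulr_sumr addrACA -big_split/=.
congr (_ + _); first by rewrite !mxE; ring.
by apply: eq_bigr => i _; rewrite !mxE; ring.
Qed.

Lemma omegaC {R : realType} {m : nat} (u v : phase R m) : omega u v = - omega v u.
Proof.
rewrite /omega /wedge opprD -sumrN; congr (_ + _); first by ring.
by apply: eq_bigr => i _; ring.
Qed.

Lemma omegaxx {R : realType} {m : nat} (u : phase R m) : omega u u = 0.
Proof. by have := omegaC u u; lra. Qed.

Lemma omega_linearr {R : realType} {m : nat} (a : R) (u v w : phase R m) :
  omega w (a *: u + v) = a * omega w u + omega w v.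
Proof. by rewrite omegaC omega_linearl (omegaC w u) (omegaC w v); ring. Qed.

Lemma omegaZr {R : realType} {m : nat} (a : R) (u v : phase R m) :
  omega u (a *: v) = a * omega u v.
Proof.
have omega0 : omega u 0 = 0.
  by have := omega_linearr (-1) 0 0 u; rewrite scaler0 addr0; lra.
by rewrite -[a *: v]addr0 omega_linearr omega0 addr0.
Qed.

Lemma omegaZl {R : realType} {m : nat} (a : R) (u v : phase R m) :
  omega (a *: u) v = a * omega u v.
Proof. by rewrite omegaC omegaZr (omegaC v) mulrN opprK. Qed.

(** A mean with positive weights lies between [f x] and [g x], so it converges whatever the ratio of
    the weights does. *)
Lemma cvg_weighted_mean {R : realType} {T : Type} {F : set_system T} {FF : Filter F}
    (a b f g : T -> R) (l : R) :
  (\forall x \near F, 0 < a x) -> (\forall x \near F, 0 < b x) ->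
  f @ F --> l -> g @ F --> l ->
  (a x * f x + b x * g x) / (a x + b x) @[x --> F] --> l.
Proof.
move=> a0 b0 /cvgrPdist_lt fl /cvgrPdist_lt gl; apply/cvgrPdist_lt => e e0.
near=> x.
have ax : 0 < a x by near: x.
have bx : 0 < b x by near: x.
have : `|l - f x| < e by near: x; exact: fl.
have : `|l - g x| < e by near: x; exact: gl.
rewrite !ltr_distlC => /andP[g1 g2] /andP[f1 f2].
rewrite ltr_pdivlMr ?ltr_pdivrMr ?addr_gt0//; apply/andP; split; nra.
Unshelve. all: by end_near. Qed.

(** * Areas spanned by chords of a curve with a second-order expansion at [t] *)

Section Chords.
Context {R : realType} {m : nat}.
Context {A : R -> phase R m} {t : R} {D DD : phase R m}.

(** For [s = -1] and [s = 1] these are the vectors B and B' of the overview; [D] and [DD] stand for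
    the first and second derivatives of [A] at [t]. *)
Let remainder (s e : R) : phase R m :=
  (e ^+ 2)^-1 *: (A (t + s * e) - A t - (s * e) *: D).

Hypothesis taylor : forall s : R,
  remainder s e @[e --> 0^'+] --> (s ^+ 2 / 2) *: DD.

(* The slope of the chord from [A t] to [A (t + s * e)], for [s = 1] or [-1]. *)
Let slope (s e : R) : phase R m := (s * e) *: remainder s e + D.

Let at_right_id : (e : R) @[e --> (0 : R)^'+] --> (0 : R).
Proof. by apply: cvg_at_right_filter; exact: cvg_id. Qed.

Let slope_cvg s : slope s e @[e --> 0^'+] --> D.
Proof.
rewrite [X in _ --> X](_ : D = (s * 0) *: ((s ^+ 2 / 2) *: DD) + D); last first.
  by rewrite mulr0 scale0r add0r.
apply: cvgD; last exact: cvg_cst.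
by apply: cvgZ; [apply: cvgM; [exact: cvg_cst|exact: at_right_id]|exact: taylor].
Qed.

(** The remainder enters with coefficient [(s * e) ^+ 2], which cancels its denominator [e ^+ 2]
    because [s ^+ 2 = 1]. *)
Let curveE (s e : R) : e != 0 -> s ^+ 2 = 1 ->
  A (t + s * e) = (s * e) *: slope s e + A t.
Proof.
move=> e0 s1; rewrite /slope scalerDr scalerA -expr2 exprMn s1 mul1r.
by rewrite /remainder scalerA divff ?expf_neq0// scale1r !subrK.
Qed.

Let leftE (e : R) : e != 0 -> A (t - e) = (- e) *: slope (-1) e + A t.
Proof.
by move=> e0; rewrite -[in LHS]mulN1r curveE ?mulN1r// sqrrN expr1n.
Qed.

Let rightE (e : R) : e != 0 -> A (t + e) = e *: slope 1 e + A t.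
Proof.
by move=> e0; rewrite -[in LHS](mul1r e) curveE ?mul1r// expr1n.
Qed.

(** Coordinate-free form of the denominator t y_t - y + x z_t - x_t z. *)
Let Delta := omega (A t) D.
Hypothesis Delta0 : Delta != 0.

Let area0_left (e : R) : e != 0 ->
  area 0 (A (t - e)) (A t) = e / 2 * omega (A t) (slope (-1) e).
Proof.
move=> e0; rewrite /area !subr0 leftE// omega_linearl omegaxx.
by rewrite (omegaC (slope _ _)); ring.
Qed.

Let omega_slope_cvg s : omega (A t) (slope s e) @[e --> 0^'+] --> Delta.
Proof. by apply: cvg_omega; [exact: cvg_cst|exact: slope_cvg]. Qed.

(** The chord is [d] times the slope and the area is [d / 2 * omega (A t) (slope (-1) d)], so [d]
    cancels. *)
Lemma chord_area_cvg :
  (area 0 (A (t - d)) (A t))^-1 *: (A t - A (t - d)) @[d --> 0^'+] -->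
  (2 / Delta) *: D.
Proof.
have : (2 / omega (A t) (slope (-1) d)) *: slope (-1) d @[d --> 0^'+] -->
    (2 / Delta) *: D.
  apply: cvgZ; last exact: slope_cvg.
  by apply: cvgM; [exact: cvg_cst|apply: cvgV => //; exact: omega_slope_cvg].
apply: cvg_trans; apply: near_eq_cvg; near=> d => /=.
have d0 : d != 0 by near: d; exact: nbhs_right_neq.
rewrite area0_left// leftE// opprD addrCA subrr addr0 scaleNr opprK scalerA.
congr (_ *: _); rewrite !invfM invrK.
(* With the inverse made opaque, [field] only has to know that [d] is nonzero. *)
by move: (omega _ _)^-1 => o; field.
Unshelve. all: by end_near. Qed.

(** With d = [p.1] and e = [p.2], the numerator is d e (d + e) w' / 2 and the three areas are d u /
    2, (d + e) x' / 2 and e v / 2. All small factors cancel, leaving 4 w' / (u x' v). *)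
Lemma triangle_area_cvg :
  ((fun p : R * R =>
      area (A (t - p.1)) (A t) (A (t + p.2)) /
      (area 0 (A (t - p.1)) (A t) * area 0 (A (t - p.1)) (A (t + p.2)) *
       area 0 (A t) (A (t + p.2))))
     @ filter_prod (0 : R)^'+ (0 : R)^'+ --> 2 * omega D DD / Delta ^+ 3).
Proof.
pose F := filter_prod (0 : R)^'+ (0 : R)^'+.
have c1 : p.1 @[p --> F] --> (0 : R)^'+ by exact: cvg_fst.
have c2 : p.2 @[p --> F] --> (0 : R)^'+ by exact: cvg_snd.
have d0 : \forall p \near F, 0 < p.1 by exact: (c1 _ (nbhs_right_gt (0 : R))).
have e0 : \forall p \near F, 0 < p.2 by exact: (c2 _ (nbhs_right_gt (0 : R))).
pose u (p : R * R) := omega (A t) (slope (-1) p.1) : R.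
pose v (p : R * R) := omega (A t) (slope 1 p.2) : R.
pose w (p : R * R) := omega (slope (-1) p.1) (slope 1 p.2) : R.
have ul : u p @[p --> F] --> Delta := cvg_comp _ _ c1 (omega_slope_cvg (-1)).
have vl : v p @[p --> F] --> Delta := cvg_comp _ _ c2 (omega_slope_cvg 1).
have sl : slope (-1) p.1 @[p --> F] --> D := cvg_comp _ _ c1 (slope_cvg (-1)).
have sr : slope 1 p.2 @[p --> F] --> D := cvg_comp _ _ c2 (slope_cvg 1).
have rl : remainder (-1) p.1 @[p --> F] --> 2^-1 *: DD.
  by have := cvg_comp _ _ c1 (taylor (-1)); rewrite sqrrN expr1n mul1r.
have rr : remainder 1 p.2 @[p --> F] --> 2^-1 *: DD.
  by have := cvg_comp _ _ c2 (taylor 1); rewrite expr1n mul1r.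
have p1 : p.1 @[p --> F] --> (0 : R) := cvg_comp _ _ c1 at_right_id.
(* This is omega(S, S') / (d + e) expanded. The cross term - d e omega(B, B') is put into the part
   of weight e, where it is a correction with the vanishing factor d. *)
pose w' (p : R * R) := (p.2 * (omega D (remainder 1 p.2) -
    p.1 * omega (remainder (-1) p.1) (remainder 1 p.2)) +
  p.1 * omega D (remainder (-1) p.1)) / (p.2 + p.1).
have w'l : w' p @[p --> F] --> omega D DD / 2.
  rewrite (mulrC _ 2^-1) -omegaZr; apply: cvg_weighted_mean => //.
    rewrite [X in _ --> X](_ : _ = omega D (2^-1 *: DD) - 0 * omega (2^-1 *: DD) (2^-1 *: DD));
      last by rewrite mul0r subr0.
    apply: cvgB; first by apply: cvg_omega => //; exact: cvg_cst.
    by apply: cvgM => //; exact: cvg_omega.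
  by apply: cvg_omega => //; exact: cvg_cst.
(* Likewise for omega(A0, A2) / (d + e), with cross term - d e omega(S, S'). *)
pose x' (p : R * R) := (p.2 * (v p - p.1 * w p) + p.1 * u p) / (p.2 + p.1).
have x'l : x' p @[p --> F] --> Delta.
  apply: cvg_weighted_mean => //.
  rewrite [X in _ --> X](_ : Delta = Delta - 0 * omega D D); last by rewrite mul0r subr0.
  by apply: cvgB => //; apply: cvgM => //; exact: cvg_omega.
have : 4 * w' p / (u p * x' p * v p) @[p --> F] --> 2 * omega D DD / Delta ^+ 3.
  rewrite (_ : 2 * _ / _ = 4 * (omega D DD / 2) / (Delta * Delta * Delta)); last by field.
  apply: cvgM; first by apply: cvgM => //; exact: cvg_cst.
  apply: cvgV; first by rewrite !mulf_neq0.
  by apply: cvgM => //; apply: cvgM.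
apply: cvg_trans; apply: near_eq_cvg; near=> p => /=.
have d1 : 0 < p.1 by near: p.
have e1 : 0 < p.2 by near: p.
have dn : p.1 != 0 by rewrite gt_eqF.
have en : p.2 != 0 by rewrite gt_eqF.
have den : p.2 + p.1 != 0 by rewrite gt_eqF// addr_gt0.
have wE : w p = (p.2 + p.1) * w' p.
  rewrite mulrC divfK// /w /slope mul1r mulN1r !(omega_linearl, omega_linearr) omegaxx.
  by rewrite (omegaC _ D); ring.
have midE : area 0 (A (t - p.1)) (A (t + p.2)) = (p.2 + p.1) / 2 * x' p.
  rewrite mulrAC [_ * x' p]mulrC divfK// /area !subr0 leftE// rightE//.
  rewrite /u /v /w; move: (slope (-1) p.1) (slope 1 p.2) => S S'.
  by rewrite omega_linearl !omega_linearr omegaxx (omegaC _ (A t)); field.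
have rightareaE : area 0 (A t) (A (t + p.2)) = p.2 / 2 * v p.
  by rewrite /area !subr0 rightE// omega_linearr omegaxx /v; ring.
have areaE : area (A (t - p.1)) (A t) (A (t + p.2)) = p.1 * p.2 / 2 * w p.
  rewrite /area leftE// rightE//.
  set S := slope (-1) p.1; set S' := slope 1 p.2.
  have -> : A t - (- p.1 *: S + A t) = p.1 *: S.
    by rewrite opprD addrCA subrr addr0 scaleNr opprK.
  have -> : p.2 *: S' + A t - (- p.1 *: S + A t) = p.1 *: S + p.2 *: S'.
    by rewrite opprD addrACA subrr addr0 scaleNr opprK addrC.
  by rewrite omega_linearr omegaZl omegaxx omegaZr omegaZl -/(w p); ring.
rewrite areaE midE rightareaE area0_left// -/(u p) wE.
(* The inverses of [u], [x'] and [v] become opaque, so [field] divides only by d, e and d + e. *)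
move: (w' p) (u p) (x' p) (v p) => k a b c; rewrite !invfM !invrK.
by move: a^-1 b^-1 c^-1 => {}a {}b {}c; field; rewrite dn en den.
Unshelve. all: by end_near. Qed.
End Chords.

(** * Coordinate computations and conclusion for the given curve *)

Lemma vecB {R : realType} {m : nat} (a c a' c' : R) (b d b' d' : 'rV[R]_m) :
  vec a b c d - vec a' b' c' d' = vec (a - a') (b - b') (c - c') (d - d').
Proof. by rewrite /vec !opp_row_mx !add_row_mx !raddfB. Qed.

Lemma vecZ {R : realType} {m : nat} (k a c : R) (b d : 'rV[R]_m) :
  k *: vec a b c d = vec (k * a) (k *: b) (k * c) (k *: d).
Proof. by rewrite /vec !scale_row_mx !scale_scalar_mx. Qed.

Lemma omega_vec {R : realType} {m : nat} (a c a' c' : R) (b d b' d' : 'rV[R]_m) :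
  omega (vec a b c d) (vec a' b' c' d') =
  a * c' - a' * c + dot b d' - dot b' d.
Proof.
rewrite /omega /wedge /tcoord /ycoord /xcoord /zcoord /dot /vec.
rewrite !(row_mxKl, row_mxKr) !mxE !eqxx !mulr1n.
by rewrite sumrB addrA.
Qed.

(** Serves the real-valued coordinate [y], as the matrix version serves [x] and [z]. *)
Lemma taylor2_at_right_scalar {R : realType} (f : R -> R) (t s : R) :
  (\forall u \near t, derivable f u 1) -> derivable (derive1 f) t 1 ->
  (e ^+ 2)^-1 * (f (t + s * e) - f t - (s * e) * derive1 f t) @[e --> 0^'+] -->
  (s ^+ 2 / 2) * derive1n 2 f t.
Proof.
move=> fd f'd; under eq_fun do rewrite mulrC.
apply: (@taylor2_at_right R f (derive1 f)).
  near=> u; rewrite derive1E; apply: derivableP.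
  by near: u.
by rewrite /= derive1E; exact: derivableP.
Unshelve. all: by end_near. Qed.

Lemma smooth_on_near {R : realType} {W : normedModType R} (I : set R) (f : R -> W) (t : R) :
  open I -> I t -> smooth_on I f -> \forall u \near t, derivable f u 1.
Proof.
move=> oI It fs; apply: filterS (open_nbhs_nbhs (conj oI It)) => u Iu.
exact: (fs 0).
Qed.

Theorem mainTheorem8 (R : realType) (m : nat) (I : set R)
  (x : R -> 'rV[R]_m) (y : R -> R) (z : R -> 'rV[R]_m) (t : R)
  (I_open : open I) (I_interval : is_interval I)
  (x_smooth : smooth_on I x) (y_smooth : smooth_on I y)
  (z_smooth : smooth_on I z) (It : I t)
  (nondegenerate :
     t * derive1 y t - y t + dot (x t) (derive1 z t) - dot (derive1 x t) (z t) != 0) :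
  let A := curve x y z in
  let Delta :=
    t * derive1 y t - y t + dot (x t) (derive1 z t) - dot (derive1 x t) (z t) in
  ((fun p : R * R =>
      let A0 := A (t - p.1) in let A1 := A t in let A2 := A (t + p.2) in
      area A0 A1 A2 / (area 0 A0 A1 * area 0 A0 A2 * area 0 A1 A2))
     @ filter_prod (0 : R)^'+ (0 : R)^'+ -->
   2 * (dot (derive1 x t) (derive1n 2 z t) - dot (derive1n 2 x t) (derive1 z t) + derive1n 2 y t)
     / Delta ^+ 3)
  /\
  ((fun d : R => (area 0 (A (t - d)) (A t))^-1 *: (A t - A (t - d)))
     @ (0 : R)^'+ --> (2 / Delta) *: total_derivative x y z t).
Proof.
move=> A Delta.
pose D := total_derivative x y z t.
(* The second derivative of the curve; its first entry is 0 because the curve is parametrized by its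
   own coordinate t. *)
pose DD := vec 0 (derive1n 2 x t) (derive1n 2 y t) (derive1n 2 z t).
have taylor (s : R) :
    (e ^+ 2)^-1 *: (A (t + s * e) - A t - (s * e) *: D) @[e --> (0 : R)^'+] -->
    (s ^+ 2 / 2) *: DD.
  rewrite /A /curve /D /total_derivative /DD vecZ.
  under eq_fun do rewrite vecZ !vecB vecZ.
  apply: cvg_vec.
  (* The t-coordinate is affine in the parameter, so its remainder vanishes identically. *)
  - under eq_fun do rewrite mulr1 addrAC addrK subrr mulr0.
    by rewrite mulr0; exact: cvg_cst.
  - by apply: taylor2_mx_at_right; [exact: smooth_on_near x_smooth|exact: (x_smooth 1)].
  - by apply: taylor2_at_right_scalar; [exact: smooth_on_near y_smooth|exact: (y_smooth 1)].
  - by apply: taylor2_mx_at_right; [exact: smooth_on_near z_smooth|exact: (z_smooth 1)].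
have DeltaE : omega (A t) D = Delta by rewrite omega_vec mul1r.
have Delta0 : omega (A t) D != 0 by rewrite DeltaE.
split; last by rewrite -DeltaE; exact: (chord_area_cvg taylor Delta0).
(* The t-entries 1 of [D] and 0 of [DD] reduce the first wedge to y_tt. *)
have omegaDDD : omega D DD = dot (derive1 x t) (derive1n 2 z t) -
    dot (derive1n 2 x t) (derive1 z t) + derive1n 2 y t.
  by rewrite omega_vec; ring.
rewrite -omegaDDD -DeltaE; exact: (triangle_area_cvg taylor Delta0).
Qed.
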